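(* For Vertex Cover in the Late Accept/Reject model, the competitive ratio is $2$; that is, there is a strictly $2$-competitive online algorithm in this model, and for every real $c<2$ no online algorithm in this model is $c$-competitive.
   Context: Online Vertex Cover (vertex arrival). An input $\sigma$ is a finite simple undirected graph $G=(V,E)$ together with an ordering of its vertices. Vertices arrive one by one in this order; when a vertex arrives, all edges between it and previously arrived vertices are revealed. All online algorithms are deterministic: each decision depends only on the part of the input revealed so far. After each arrival has been processed, the set of currently accepted vertices must be a vertex cover of the graph revealed so far (every edge has at least one accepted endpoint). $\mathrm{ALG}(\sigma)$ is the number of accepted vertices at the end of the input, and $\mathrm{OPT}(\sigma)$ is the minimum cardinality of a vertex cover of $G$; the objective is minimization. Late Accept/Reject model: in each step the algorithm may accept the newly arrived vertex and any earlier vertices that have not been late-rejected, and it may remove (late-reject) accepted vertices; a late-rejected vertex can never be accepted again. An algorithm $\mathrm{ALG}$ is $c$-competitive if there is a constant $\alpha$ such that $\mathrm{ALG}(\sigma)\le c\,\mathrm{OPT}(\sigma)+\alpha$ for all inputs $\sigma$; it is strictly $c$-competitive if this holds with $\alpha=0$. By convention, ''the competitive ratio is $c$'' includes that the upper bound holds for the strict competitive ratio and the lower bound for the (non-strict) competitive ratio. *)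

(* Defs.v *)
From HB Require Import structures.
From mathcomp Require Import all_boot all_order all_algebra finmap reals.

Set Implicit Arguments.
Unset Strict Implicit.
Unset Printing Implicit Defensive.

Import Order.TTheory GRing.Theory Num.Theory.

Local Open Scope fset_scope.

Definition edge_of (V : {fset nat}) (e : {fset nat}) : bool :=
  (#|` e| == 2) && (e `<=` V).

(* Vertices are natural numbers, without loss of generality since graphs are
   finite; [arrivals] lists V in arrival order, and simple undirected edges are
   two-element subsets of V. *)
Record input := Input {
  arrivals : seq nat;
  edges : {fset {fset nat}};
  arrivals_uniq : uniq arrivals;
  edgesP : [forall e : edges, edge_of [fset v in arrivals] (val e)]
}.

Definition vertices (sigma : input) : {fset nat} := [fset v in arrivals sigma].

Section Revealed.
Variables (sigma : input) (k : nat).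

Definition revealed_arrivals : seq nat := take k (arrivals sigma).

Definition revealed_edges : {fset {fset nat}} :=
  [fset e in edges sigma | e `<=` [fset v in revealed_arrivals]].

Lemma revealed_arrivals_uniq : uniq revealed_arrivals.
Proof. exact: take_uniq (arrivals_uniq sigma). Qed.

Lemma revealed_edgesP :
  [forall e : revealed_edges, edge_of [fset v in revealed_arrivals] (val e)].
Proof.
apply/forallP => -[e /=]; rewrite !inE /= => /andP[eE sub].
have /forallP/(_ [` eE]) /andP[/= card2 _] := edgesP sigma.
by rewrite /edge_of card2.
Qed.

(* The part of [sigma] known once its first [k] vertices have arrived. *)
Definition revealed : input := Input revealed_arrivals_uniq revealed_edgesP.

End Revealed.

Definition vertex_cover (E : {fset {fset nat}}) (S : {fset nat}) : bool :=
  [forall e : E, val e `&` S != fset0].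

(* The default value of the minimum is harmless: the whole vertex set is itself
   a vertex cover. *)
Definition OPT (sigma : input) : nat :=
  \big[minn/#|` vertices sigma|]_(S <- fpowerset (vertices sigma)
                                  | vertex_cover (edges sigma) S) #|` S|.

Record decision := Decision { accept : {fset nat}; remove : {fset nat} }.

(* A deterministic online algorithm maps the revealed input, whose last arrival
   is the vertex being processed, to a decision.  Its own earlier decisions are
   determined by the revealed input. *)
Definition algorithm := input -> decision.

Record state := State { accepted : {fset nat}; late_rejected : {fset nat} }.

(* Acceptances take effect before removals. *)
Definition step (s : state) (d : decision) : state :=
  State ((accepted s `|` accept d) `\` remove d)
        (late_rejected s `|` remove d).

Fixpoint run (A : algorithm) (sigma : input) (k : nat) : state :=
  if k is k'.+1 then step (run A sigma k') (A (revealed sigma k))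
  else State fset0 fset0.

(* [V] is the set of vertices that have arrived, including the new one. *)
Definition late_accept_reject_legal
    (V : {fset nat}) (s : state) (d : decision) : bool :=
  (accept d `<=` V `\` late_rejected s) &&
  (remove d `<=` accepted s `|` accept d).

Definition late_accept_reject_algorithm (A : algorithm) : Prop :=
  forall (sigma : input) (k : nat), k < size (arrivals sigma) ->
    late_accept_reject_legal (vertices (revealed sigma k.+1))
      (run A sigma k) (A (revealed sigma k.+1)) /\
    vertex_cover (edges (revealed sigma k.+1)) (accepted (run A sigma k.+1)).

Definition ALG (A : algorithm) (sigma : input) : nat :=
  #|` accepted (run A sigma (size (arrivals sigma)))|.

Local Open Scope ring_scope.

Definition competitive_with (R : realType) (A : algorithm) (c alpha : R) : Prop :=
  forall sigma : input, (ALG A sigma)%:R <= c * (OPT sigma)%:R + alpha.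

Definition competitive (R : realType) (A : algorithm) (c : R) : Prop :=
  exists alpha : R, competitive_with A c alpha.

Definition strictly_competitive (R : realType) (A : algorithm) (c : R) : Prop :=
  competitive_with A c 0.

(* Main.v *)
Require Import Defs.
From HB Require Import structures.
From mathcomp Require Import all_boot all_order all_algebra finmap reals.
From mathcomp Require Import lra zify.

Import Order.TTheory GRing.Theory Num.Theory.
Local Open Scope ring_scope.

Set Implicit Arguments.
Unset Strict Implicit.

(** Upper bound: accept both endpoints of the edges of a greedily built maximal
    matching; each such edge costs any vertex cover at least one vertex.
    Lower bound: a late-rejected vertex is fatal, since attaching leaves to it
    forces every leaf to be accepted while OPT stays bounded.  So a competitive
    algorithm never rejects.  Then, after an edge ab is revealed, at least one of
    a, b is accepted; a third vertex attached to the other one yields a path on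
    three vertices with at least two accepted vertices, while its middle
    vertex is a cover.  Disjoint copies of this gadget give the ratio 2. *)

Local Open Scope fset_scope.
Local Open Scope nat_scope.

(** * Inputs, edges, covers and the optimum *)

Lemma input_eq (sigma tau : input) :
  arrivals sigma = arrivals tau -> edges sigma = edges tau -> sigma = tau.
Proof.
case: sigma tau => s E us sE [t F ut tF] /= est eEF; subst t F.
by rewrite (bool_irrelevance us ut) (bool_irrelevance sE tF).
Qed.

Lemma edge_sub (sigma : input) (e : {fset nat}) :
  e \in edges sigma -> e `<=` vertices sigma.
Proof. by move=> eE; have /forallP/(_ [` eE])/andP[] := edgesP sigma. Qed.

Lemma card_edge (sigma : input) (e : {fset nat}) :
  e \in edges sigma -> #|` e| = 2.
Proof. by move=> eE; have /forallP/(_ [` eE])/andP[/eqP] := edgesP sigma. Qed.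

Lemma edgeE {sigma : input} {e : {fset nat}} : e \in edges sigma ->
  exists u v, [/\ u \in arrivals sigma, v \in arrivals sigma, u != v
                & e = [fset u; v]].
Proof.
move=> eE; have ce := card_edge eE.
have /fset0Pn[u ue] : e != fset0 by rewrite -cardfs_gt0 ce.
have /cardfs1P[v ev] : #|` e `\ u| == 1 by move: ce; rewrite (cardfsD1 u) ue; lia.
have uv : u != v.
  by have := fset11 v; rewrite -ev !inE eq_sym => /andP[].
have euv : e = [fset u; v] by rewrite -ev fsetD1K.
have /fsubsetP sub := edge_sub eE; exists u, v; split=> //.
- by have := sub u; rewrite euv !inE eqxx; apply.
- by have := sub v; rewrite euv !inE eqxx orbT; apply.
Qed.

Lemma vertex_coverP {E : {fset {fset nat}}} {S : {fset nat}} :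
  reflect (forall e, e \in E -> e `&` S != fset0) (vertex_cover E S).
Proof.
apply: (iffP forallP) => [H e eE | H e]; last exact/H/valP.
exact: (H [` eE]).
Qed.

Lemma cover_edge {E : {fset {fset nat}}} {S : {fset nat}} {u v : nat} :
  vertex_cover E S -> [fset u; v] \in E -> (u \in S) || (v \in S).
Proof.
move=> /vertex_coverP covS /covS /fset0Pn[w]; rewrite !inE.
by case/andP=> /orP[] /eqP -> ->; rewrite ?orbT.
Qed.

Lemma OPT_leq (sigma : input) (C : {fset nat}) :
  C `<=` vertices sigma -> vertex_cover (edges sigma) C ->
  OPT sigma <= #|` C|.
Proof.
move=> CV covC; rewrite /OPT.
(* The induction runs over the list underlying the power set, where [C] contributes its own term to
   the minimum. *)
have: C \in enum_fset (fpowerset (vertices sigma)) by rewrite -fpowersetE in CV.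
elim: (enum_fset _) => // S r IH; rewrite inE big_cons => /orP[/eqP <-|Cr].
  by rewrite covC geq_minl.
by case: ifP => _; rewrite ?geq_min IH ?orbT.
Qed.

Lemma OPT_witness (sigma : input) :
  exists2 C, vertex_cover (edges sigma) C & #|` C| = OPT sigma.
Proof.
rewrite /OPT; elim/big_rec: _ => [|S _ covS [C covC <-]].
  (* The default value of the minimum is attained by the whole vertex set, which meets each edge in
     both endpoints. *)
  exists (vertices sigma) => //; apply/vertex_coverP => e eE.
  by rewrite (fsetIidPl (edge_sub eE)) -cardfs_eq0 (card_edge eE).
by case: (leqP #|` S| #|` C|) => _; [exists S | exists C].
Qed.

Lemma revealed_size (sigma : input) :
  revealed sigma (size (arrivals sigma)) = sigma.
Proof.
apply: input_eq; rewrite /= ?/revealed_edges /revealed_arrivals take_size //.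
apply/fsetP => e; rewrite !inE /=; case eE: (e \in _) => //=.
exact: edge_sub.
Qed.

(** * Upper bound: greedy maximal matching *)

Section GreedyMatching.
Variable E : {fset {fset nat}}.

(* [s] lists the arrived vertices, the most recent one first. *)
Fixpoint greedy (s : seq nat) : {fset nat} :=
  if s is v :: s' then
    let S := greedy s' in
    if [seq u <- s' | (u \notin S) && ([fset u; v] \in E)] is u :: _
    then u |` (v |` S) else S
  else fset0.

Lemma greedy_cons (v : nat) (s : seq nat) :
  (exists u, [/\ u \in s, u \notin greedy s, [fset u; v] \in E
               & greedy (v :: s) = u |` (v |` greedy s)]) \/
  (greedy (v :: s) = greedy s /\
   forall u, u \in s -> u \notin greedy s -> [fset u; v] \notin E).
Proof.
rewrite /=; case Dr: [seq u <- s | _] => [|u r]; [right | left].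
  split=> // u us uS; apply/negP => uvE.
  by have: u \in [::] by rewrite -Dr mem_filter uS uvE.
have: u \in u :: r by rewrite mem_head.
by rewrite -Dr mem_filter => /andP[/andP[uS uvE] us]; exists u.
Qed.

Lemma greedy_mono (v : nat) (s : seq nat) : greedy s `<=` greedy (v :: s).
Proof.
case: (greedy_cons v s) => [[u [_ _ _ ->]] | [-> //]].
by rewrite fsetUA fsubsetUr.
Qed.

Lemma greedy_sub (s : seq nat) : {subset greedy s <= s}.
Proof.
elim: s => [|v s IH] w; first by rewrite inE.
case: (greedy_cons v s) => [[u [us _ _ ->]] | [-> _]].
  rewrite !inE => /orP[/eqP->|/orP[->//|/IH->]]; by rewrite ?us orbT.
by rewrite inE => /IH->; rewrite orbT.
Qed.

(** This is maximality of the matching: when the later endpoint arrives, either the earlier one is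
    already matched, or the newcomer gets matched to some unmatched neighbour. Matched vertices stay
    matched. *)
Lemma greedy_cover (s : seq nat) (u v : nat) :
  u \in s -> v \in s -> u != v -> [fset u; v] \in E ->
  (u \in greedy s) || (v \in greedy s).
Proof.
elim: s u v => // x s IH.
have new u : u \in s -> [fset u; x] \in E ->
    (u \in greedy (x :: s)) || (x \in greedy (x :: s)).
  move=> us uxE; case: (greedy_cons x s) => [[w [_ _ _ ->]] | [-> H]].
    by rewrite !inE eqxx !orbT.
  by apply/orP; left; apply: contraLR uxE; apply: H.
move=> u v; rewrite !(inE, in_cons) => /orP[/eqP->|us] /orP[/eqP->|vs].
- by rewrite eqxx.
- by move=> _; rewrite fsetUC orbC; apply: new.
- by move=> _; apply: new.
move=> uv uvE; have /fsubsetP mono := greedy_mono x s.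
by case/orP: (IH u v us vs uv uvE) => /mono ->; rewrite ?orbT.
Qed.

(** Each matched pair adds two vertices on the left and at least one on the right. Intersecting [C]
    with the matched set keeps the cover vertices charged to different pairs distinct. *)
Lemma card_greedy (s : seq nat) (C : {fset nat}) :
  uniq s -> vertex_cover E C -> #|` greedy s| <= 2 * #|` greedy s `&` C|.
Proof.
move=> us covC; elim: s us => [|v s IH /= /andP[vs us]]; first by [].
case: (greedy_cons v s) => [[u [us' uS uvE /= ->]] | [/= -> _]]; last exact: IH.
have vS : v \notin greedy s by apply: contra vs; apply: greedy_sub.
have uv : u != v by apply: contraNneq vs => <-.
have uvS : u \notin v |` greedy s by rewrite !inE negb_or uv.
rewrite !cardfsU1 uvS vS !fsetIUl.
(* The endpoint that covers the matched edge is charged; both endpoints were unmatched before, so it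
   is new. *)
have [w [wuv wC]] : exists w, w \in [fset u; v] /\ w \in C.
  by case/orP: (cover_edge covC uvE) => ?; [exists u | exists v]; rewrite !inE eqxx ?orbT.
have wS : w \notin greedy s.
  by move: wuv; rewrite !inE => /orP[] /eqP ->.
have sub : w |` (greedy s `&` C) `<=`
    [fset u] `&` C `|` ([fset v] `&` C `|` greedy s `&` C).
  apply/fsubsetP => x; rewrite !inE => /orP[/eqP->|/andP[-> ->]]; last by rewrite !orbT.
  by move: wuv; rewrite !inE wC !andbT => /orP[] -> ; rewrite ?orbT.
have := fsubset_leq_card sub; rewrite cardfsU1 !inE (negbTE wS) /=.
move=> leC; apply: leq_trans (leq_mul (leqnn 2) leC).
by rewrite addnA mulnDr leq_add ?IH.
Qed.

End GreedyMatching.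

(** Only pairs of vertices of [s] are ever tested. This locality makes the rule online: the revealed
    edges give the same result as all edges. *)
Lemma eq_greedy (E F : {fset {fset nat}}) (s : seq nat) :
  (forall e : {fset nat}, e `<=` [fset v in s] -> (e \in E) = (e \in F)) ->
  greedy E s = greedy F s.
Proof.
elim: s => //= v s IH EF.
have -> : greedy E s = greedy F s.
  apply: IH => e es; apply: EF; apply: fsubset_trans es _.
  by apply/fsubsetP => w; rewrite !inE /= => ->; rewrite orbT.
congr (if _ is u :: _ then _ else _); apply: eq_in_filter => u us.
rewrite EF //; apply/fsubsetP => w; rewrite !inE /=.
by case/orP=> /eqP->; rewrite ?us ?eqxx ?orbT.
Qed.

(** The matched set is recomputed and accepted as a whole in every round; [rev] puts the newest
    arrival first, as [greedy] expects. *)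
Definition greedy_algorithm (sigma : input) : decision :=
  Decision (greedy (edges sigma) (rev (arrivals sigma))) fset0.

Lemma greedy_revealed (sigma : input) (k : nat) :
  greedy_algorithm (revealed sigma k) =
  Decision (greedy (edges sigma) (rev (take k (arrivals sigma)))) fset0.
Proof.
congr Decision; rewrite /= /revealed_arrivals; apply: eq_greedy => e es.
rewrite !inE /=; apply: andb_idr => _; apply: fsubset_trans es _.
by apply/fsubsetP => w; rewrite !inE /= mem_rev.
Qed.

Lemma run_greedy (sigma : input) (k : nat) : k <= size (arrivals sigma) ->
  run greedy_algorithm sigma k =
  State (greedy (edges sigma) (rev (take k (arrivals sigma)))) fset0.
Proof.
elim: k => [|k IH] ks; first by rewrite take0.
rewrite [run _ _ _]/= greedy_revealed IH 1?ltnW // /step /= fsetD0 fsetU0.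
rewrite (take_nth 0 ks) rev_rcons.
(* By monotonicity the recomputed set absorbs what was accepted before. *)
by rewrite (fsetUidPr _ _ (greedy_mono _ _ _)).
Qed.

Lemma greedy_legal : late_accept_reject_algorithm greedy_algorithm.
Proof.
move=> sigma k ks; rewrite !run_greedy ?(ltnW ks) // greedy_revealed; split.
  rewrite /late_accept_reject_legal /= fsetD0 fsub0set andbT.
  by apply/fsubsetP => v /greedy_sub; rewrite mem_rev !inE.
apply/vertex_coverP => e eE; have [u [v [us vs uv euv]]] := edgeE eE.
have uvE : [fset u; v] \in edges sigma.
  by move: eE; rewrite -euv !inE /= => /andP[].
apply/fset0Pn; rewrite euv.
rewrite /= -mem_rev in us; rewrite /= -mem_rev in vs.
by case/orP: (greedy_cover us vs uv uvE) => w; [exists u | exists v];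
  rewrite !inE eqxx ?orbT.
Qed.

Lemma greedy_strictly_competitive (R : realType) :
  strictly_competitive greedy_algorithm (2%:R : R)%R.
Proof.
move=> sigma; rewrite addr0 -natrM ler_nat /ALG run_greedy // take_size /=.
have [C covC <-] := OPT_witness sigma.
apply: leq_trans (card_greedy _ covC) _; first by rewrite rev_uniq arrivals_uniq.
by rewrite leq_mul2l fsubset_leq_card ?fsubsetIr.
Qed.

(** * Extending an input by one vertex *)

Definition fresh (sigma : input) : nat := (\max_(v <- arrivals sigma) v).+1.

Lemma fresh_notin (sigma : input) : fresh sigma \notin arrivals sigma.
Proof.
apply/negP => fr.
by have := leq_bigmax_seq (P := predT) (F := id) (fresh sigma) fr isT; rewrite /= ltnn.
Qed.

Lemma fresh_vertex (sigma : input) : fresh sigma \notin vertices sigma.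
Proof. by rewrite inE /= fresh_notin. Qed.

Section Extension.
Variables (sigma : input) (N : {fset nat}).

Definition extend_arrivals : seq nat := rcons (arrivals sigma) (fresh sigma).

(** Intersecting the prescribed neighbourhood [N] with the present vertices yields a valid input for
    every [N]. *)
Definition extend_edges : {fset {fset nat}} :=
  edges sigma `|` [fset [fset u; fresh sigma] | u in N `&` vertices sigma].

Lemma extend_arrivals_uniq : uniq extend_arrivals.
Proof. by rewrite rcons_uniq fresh_notin arrivals_uniq. Qed.

Lemma extend_edgesP :
  [forall e : extend_edges, edge_of [fset v in extend_arrivals] (val e)].
Proof.
apply/forallP => -[e /=]; rewrite inE => /orP[eE | /imfsetP[u /= uN ->]].
  rewrite /edge_of (card_edge eE) eqxx /=.
  apply: fsubset_trans (edge_sub eE) _.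
  by apply/fsubsetP => w; rewrite !inE mem_rcons inE /= => ->; rewrite orbT.
move: uN; rewrite !inE /= => /andP[_ us].
rewrite /edge_of cardfs2; apply/andP; split.
  by rewrite eqSS eqb1; apply: contraNneq (fresh_notin sigma) => <-.
apply/fsubsetP => w; rewrite !inE mem_rcons inE /=.
by case/orP => /eqP->; rewrite ?eqxx ?us ?orbT.
Qed.

Definition extend : input := Input extend_arrivals_uniq extend_edgesP.

Lemma vertices_extend : vertices extend = fresh sigma |` vertices sigma.
Proof. by apply/fsetP => w; rewrite !inE mem_rcons inE. Qed.

Lemma size_extend : size (arrivals extend) = (size (arrivals sigma)).+1.
Proof. by rewrite size_rcons. Qed.

Lemma revealed_extend (k : nat) : k <= size (arrivals sigma) ->
  revealed extend k = revealed sigma k.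
Proof.
move=> ks; have tk : take k extend_arrivals = take k (arrivals sigma).
  by rewrite /extend_arrivals -cats1 takel_cat.
apply: input_eq; rewrite /= /revealed_arrivals //=.
apply/fsetP => e; rewrite !inE /= /revealed_arrivals /= tk.
(* Every added edge contains the fresh vertex, which is not among the first [k] arrivals. *)
case: (e \in edges sigma) => //=; apply/negP => /andP[/imfsetP[u /= _ ->]].
move=> /fsubsetP/(_ (fresh sigma)); rewrite !inE eqxx orbT => /(_ isT) /= /mem_take.
by apply/negP/fresh_notin.
Qed.

Lemma run_extend (A : algorithm) (k : nat) : k <= size (arrivals sigma) ->
  run A extend k = run A sigma k.
Proof. by elim: k => //= k IH ks; rewrite IH 1?ltnW // revealed_extend. Qed.

End Extension.

Definition final (A : algorithm) (sigma : input) : state :=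
  run A sigma (size (arrivals sigma)).

(** Earlier rounds do not see the new vertex, so an adversary may choose [N] after inspecting the
    final state on [sigma]. *)
Lemma final_extend (A : algorithm) (sigma : input) (N : {fset nat}) :
  final A (extend sigma N) = step (final A sigma) (A (extend sigma N)).
Proof.
rewrite /final (size_extend sigma N) [run _ _ _]/= run_extend //.
by rewrite -(size_extend sigma N) revealed_size.
Qed.

(** * Lower bound: invariants of legal runs *)

Section Adversary.
Variables (A : algorithm) (A_legal : late_accept_reject_algorithm A).

Lemma final_cover (sigma : input) :
  vertex_cover (edges sigma) (accepted (final A sigma)).
Proof.
(* Legality speaks of covers only after an arrival, so the empty input is treated separately. *)
have [s0|sP] := posnP (size (arrivals sigma)).
  apply/vertex_coverP => e /edgeE[u [v [us]]].
  by rewrite (size0nil s0) in us.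
have /A_legal[_] : (size (arrivals sigma)).-1 < size (arrivals sigma) by rewrite prednK.
by rewrite prednK // revealed_size.
Qed.

(** Disjointness persists because removals are subtracted after acceptances, and legality bars
    accepting a vertex that was late-rejected earlier. *)
Lemma run_invariant (sigma : input) (k : nat) : k <= size (arrivals sigma) ->
  [/\ accepted (run A sigma k) `<=` vertices sigma,
      late_rejected (run A sigma k) `<=` vertices sigma
    & [disjoint accepted (run A sigma k) & late_rejected (run A sigma k)]%fset].
Proof.
elim: k => [|k IH] ks; first by rewrite !fsub0set fdisjoint0X.
have [/fsubsetP aV /fsubsetP rV /fdisjointP dis] := IH (ltnW ks).
have [/andP[/fsubsetP acc /fsubsetP rem] _] := A_legal ks.
have accV v : v \in accept (A (revealed sigma k.+1)) -> v \in vertices sigma.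
  by move/acc; rewrite !inE => /andP[_ /mem_take].
split=> /=.
- apply/fsubsetP => v; rewrite inE => /andP[_]; rewrite inE => /orP[/aV|/accV] //.
- apply/fsubsetP => v; rewrite inE => /orP[/rV //|/rem].
  by rewrite inE => /orP[/aV|/accV].
apply/fdisjointP => v; rewrite !inE negb_or => /andP[->] /orP[/dis->//|/acc].
by rewrite inE => /andP[->].
Qed.

Lemma accepted_sub (sigma : input) : accepted (final A sigma) `<=` vertices sigma.
Proof. by have [] := run_invariant (leqnn (size (arrivals sigma))). Qed.

(** * Leaves attached to a late-rejected vertex *)

Fixpoint add_leaves (sigma : input) (a m : nat) : input :=
  if m is m'.+1 then extend (add_leaves sigma a m') [fset a] else sigma.

(** All new edges contain the old vertex [a], so the old vertices remain a cover. This bounds the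
    optimum independently of [m]. *)
Lemma add_leavesP (sigma : input) (a m : nat) : a \in vertices sigma ->
  [/\ vertices sigma `<=` vertices (add_leaves sigma a m),
      #|` vertices (add_leaves sigma a m)| = #|` vertices sigma| + m,
      vertex_cover (edges (add_leaves sigma a m)) (vertices sigma)
    & forall v, v \in vertices (add_leaves sigma a m) `\` vertices sigma ->
      [fset a; v] \in edges (add_leaves sigma a m)].
Proof.
move=> aV; elim: m => [|m [sub card cov lvs]].
  rewrite addn0; split=> // [|v]; last by rewrite fsetDv inE.
  apply/vertex_coverP => e eE.
  by rewrite (fsetIidPl (edge_sub eE)) -cardfs_eq0 (card_edge eE).
rewrite [add_leaves _ _ _]/= vertices_extend.
set tau := add_leaves sigma a m in sub card cov lvs *.
have new : [fset a; fresh tau] \in edges (extend tau [fset a]).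
  rewrite inE; apply/orP; right; apply/imfsetP; exists a => //=.
  by rewrite !inE eqxx; move/fsubsetP: sub => /(_ a aV); rewrite !inE.
split.
- by apply: fsubset_trans sub _; rewrite fsubsetUr.
- by rewrite cardfsU1 !inE /= fresh_notin card addnS.
- apply/vertex_coverP => e; rewrite inE => /orP[|/imfsetP[u /= uN ->]].
    exact/vertex_coverP.
  apply/fset0Pn; exists a; rewrite inE aV andbT.
  by move: uN; rewrite !inE => /andP[/eqP-> _]; rewrite eqxx.
move=> v; rewrite in_fsetD in_fset1U => /andP[vV /orP[/eqP->//|vt]].
by rewrite inE lvs // in_fsetD vV.
Qed.

Lemma add_leaves_rejected (sigma : input) (a m : nat) :
  a \in late_rejected (final A sigma) ->
  a \in late_rejected (final A (add_leaves sigma a m)).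
Proof. by move=> ar; elim: m => //= m IH; rewrite final_extend inE IH. Qed.

(** As [a] can never be accepted again, the edge from [a] to each leaf must be covered by the
    leaf. *)
Lemma ALG_add_leaves (sigma : input) (a m : nat) :
  a \in late_rejected (final A sigma) -> m <= ALG A (add_leaves sigma a m).
Proof.
move=> ar; have [_ /fsubsetP rV _] := run_invariant (leqnn (size (arrivals sigma))).
have [sub card _ lvs] := add_leavesP m (rV a ar).
set tau := add_leaves sigma a m in sub card lvs *.
have aN : a \notin accepted (final A tau).
  have [_ _ dis] := run_invariant (leqnn (size (arrivals tau))).
  by rewrite fdisjoint_sym in dis; apply: (fdisjointP dis); apply: add_leaves_rejected.
have {lvs} lvs : vertices tau `\` vertices sigma `<=` accepted (final A tau).
  apply/fsubsetP => v /lvs avE.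
  by have := cover_edge (final_cover tau) avE; rewrite (negbTE aN).
by have := fsubset_leq_card lvs; rewrite cardfsD (fsetIidPr sub) card addKn.
Qed.

(** * Path gadgets against an algorithm that never rejects *)

Section NeverRejecting.
Hypothesis no_reject : forall sigma, late_rejected (final A sigma) = fset0.

Lemma accepted_extend (sigma : input) (N : {fset nat}) :
  accepted (final A sigma) `<=` accepted (final A (extend sigma N)).
Proof.
have := no_reject (extend sigma N); rewrite final_extend /= => /eqP.
by rewrite fsetU_eq0 => /andP[_ /eqP->]; rewrite fsetD0 fsubsetUl.
Qed.

Lemma extend_edge (sigma : input) (u : nat) : u \in vertices sigma ->
  edges (extend sigma [fset u]) = [fset u; fresh sigma] |` edges sigma.
Proof.
move=> uV; apply/fsetP => e; rewrite in_fset1U in_fsetU orbC; congr (_ || _).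
apply/imfsetP/eqP => /= [[w] | ->]; first by rewrite !inE => /andP[/eqP-> _].
by exists u => //=; rewrite inE uV !inE eqxx.
Qed.

Lemma extend_isolated (sigma : input) :
  edges (extend sigma fset0) = edges sigma.
Proof. by rewrite /= /extend_edges fset0I imfset0 fsetU0. Qed.

(** The gadget is a path with vertices [y], [x], [c], disjoint from [sigma] and built in three
    arrivals. Its centre [x] covers both edges, while the algorithm pays for [y] and for one of [x]
    and [c]. *)
Lemma add_gadget (sigma : input) : exists tau x,
  [/\ vertices sigma `<=` vertices tau, x \in vertices tau,
      forall C, vertex_cover (edges sigma) C ->
        vertex_cover (edges tau) (x |` C)
    & ALG A sigma + 2 <= ALG A tau].
Proof.
pose s1 := extend sigma fset0; pose a := fresh sigma.
pose s2 := extend s1 [fset a]; pose b := fresh s1.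
have V1 : vertices s1 = a |` vertices sigma by exact: vertices_extend.
have V2 : vertices s2 = b |` vertices s1 by exact: vertices_extend.
have aV1 : a \in vertices s1 by rewrite V1 !inE eqxx.
have E2 : edges s2 = [fset a; b] |` edges sigma.
  by rewrite extend_edge // extend_isolated.
have ab : a != b by apply: contraTneq aV1 => ->; exact: fresh_vertex.
have aN : a \notin vertices sigma by exact: fresh_vertex.
have bN : b \notin vertices sigma.
  by apply: contraNN (fresh_vertex s1) => bV; rewrite V1 in_fset1U bV orbT.
(* Adaptive choice: [y] is an accepted endpoint of the first edge, and the other endpoint [x]
   becomes the centre of the path. *)
have [x [y [xyE xy xV yS]]] : exists x y : nat,
    [/\ [fset x; y] = [fset a; b], x != y, x \in vertices s2
      & y \in accepted (final A s2)].
  have abE : [fset a; b] \in edges s2 by rewrite E2 !inE eqxx.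
  case/orP: (cover_edge (final_cover s2) abE) => ?; [exists b, a | exists a, b];
    split=> //; rewrite ?V2 ?in_fset1U ?aV1 ?eqxx ?orbT //.
  - by rewrite fsetUC.
  - by rewrite eq_sym.
pose s3 := extend s2 [fset x]; pose c := fresh s2.
have V3 : vertices s3 = c |` vertices s2 by exact: vertices_extend.
have cN2 : c \notin vertices s2 by exact: fresh_vertex.
have E3 : edges s3 = [fset x; c] |` ([fset x; y] |` edges sigma).
  by rewrite extend_edge // E2 xyE.
exists s3, x; split.
- by rewrite V3 V2 V1 !fsetUA fsubsetUr.
- by rewrite V3 inE xV orbT.
- move=> C /vertex_coverP covC; apply/vertex_coverP => e.
  rewrite E3 !in_fset1U => /or3P[/eqP->|/eqP->|/covC/fset0Pn[w]].
  + by apply/fset0Pn; exists x; rewrite !inE eqxx.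
  + by apply/fset0Pn; exists x; rewrite !inE eqxx.
  by rewrite inE => /andP[we wC]; apply/fset0Pn; exists w; rewrite !inE we wC orbT.
have /fsubsetP mono12 : accepted (final A sigma) `<=` accepted (final A s2).
  exact: fsubset_trans (accepted_extend _ _) (accepted_extend _ _).
have /fsubsetP mono23 := accepted_extend s2 [fset x].
have /fsubsetP SV := accepted_sub sigma.
have abN (w : nat) : w \in [fset x; y] -> w \notin accepted (final A sigma).
  by rewrite xyE !inE => /orP[] /eqP->; apply: contra (SV _) _.
have yV2 : y \in vertices s2 by apply: (fsubsetP (accepted_sub s2)).
have cN : c \notin accepted (final A sigma).
  by apply: contraNN cN2 => /SV cV; rewrite V2 V1 in_fset1U in_fset1U cV !orbT.
(* The vertex [z] is whichever endpoint of the second edge is accepted; it differs from [y], which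
   stays accepted as nothing is removed. *)
have [z [zy zN zS]] : exists z : nat, [/\ z != y, z \notin accepted (final A sigma)
    & z \in accepted (final A s3)].
  have xcE : [fset x; c] \in edges s3 by rewrite E3 !inE eqxx.
  case/orP: (cover_edge (final_cover s3) xcE) => ?; [exists x | exists c]; split=> //.
    by apply: abN; rewrite !inE eqxx.
  by apply: contraNneq cN2 => ->.
have yN : y \notin accepted (final A sigma) by apply: abN; rewrite !inE eqxx orbT.
have sub : z |` (y |` accepted (final A sigma)) `<=` accepted (final A s3).
  apply/fsubsetP => w; rewrite !inE => /or3P[/eqP->//|/eqP->|/mono12/mono23 //].
  exact: mono23.
have := fsubset_leq_card sub.
rewrite !cardfsU1 in_fset1U negb_or zy zN yN /ALG -!/(final _ _) /=; lia.
Qed.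

Lemma gadgets (n : nat) : exists sigma, OPT sigma <= n /\ 2 * n <= ALG A sigma.
Proof.
(* The induction carries an explicit cover, to which each gadget adds its centre, and passes to
   [OPT] only at the end. *)
suff [sigma [C [CV covC Cn Sn]]] : exists sigma C,
    [/\ C `<=` vertices sigma, vertex_cover (edges sigma) C, #|` C| <= n
      & 2 * n <= ALG A sigma].
  by exists sigma; split=> //; apply: leq_trans Cn; apply: OPT_leq.
elim: n => [|n [sigma [C [CV covC Cn Sn]]]].
  have P : [forall e : (fset0 : {fset {fset nat}}), edge_of [fset v in [::]] (val e)].
    by apply/forallP => -[].
  exists (@Input [::] fset0 isT P), fset0; split=> //.
  by apply/vertex_coverP.
have [tau [x [sub xV covx STn]]] := add_gadget sigma.
exists tau, (x |` C); split.
- by rewrite fsubUset fsub1set xV (fsubset_trans CV).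
- exact: covx.
- by rewrite cardfsU1 -add1n leq_add ?leq_b1.
- lia.
Qed.

End NeverRejecting.

(** * No competitive ratio below 2 *)

Variables (R : realType) (c : R).
Local Open Scope ring_scope.

Lemma competitive_no_reject (sigma : input) :
  0 <= c -> competitive A c -> late_rejected (final A sigma) = fset0.
Proof.
move=> c0 [alpha comp]; apply/eqP; apply: contraT => /fset0Pn[a ar].
have [_ /fsubsetP rV _] := run_invariant (leqnn (size (arrivals sigma))).
(* [B] would bound the cost on all inputs obtained by attaching leaves to [a], yet with [m] leaves
   the cost is at least [m]. *)
pose B := c * #|` vertices sigma|%:R + alpha.
have [m Bm] : exists m, B < m%:R.
  exists (Num.Def.archi_bound `|B|); apply: le_lt_trans (ler_norm B) _.
  by apply: archi_boundP.
have [sub _ cov _] := add_leavesP m (rV a ar).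
have := comp (add_leaves sigma a m); rewrite leNgt => /negP[].
apply: le_lt_trans (_ : B < _); last first.
  by apply: lt_le_trans Bm _; rewrite ler_nat ALG_add_leaves.
by rewrite lerD2r ler_wpM2l // ler_nat OPT_leq.
Qed.

Lemma not_competitive : 0 <= c -> c < 2%:R -> ~ competitive A c.
Proof.
move=> c0 c2 cmp.
have [alpha comp] := cmp.
have d0 : 0 < 2%:R - c by rewrite subr_gt0.
(* With [n] gadgets, competitiveness would give [2 * n <= c * n + alpha], which fails once [n]
   exceeds this quotient. *)
have [n hn] : exists n, alpha / (2%:R - c) < n%:R.
  exists (Num.Def.archi_bound `|alpha / (2%:R - c)|).
  by apply: le_lt_trans (ler_norm _) _; apply: archi_boundP.
have [sigma [On Sn]] := gadgets (fun tau => competitive_no_reject tau c0 cmp) n.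
have h1 : (2 * n)%:R <= (ALG A sigma)%:R :> R by rewrite ler_nat.
have h2 : c * (OPT sigma)%:R <= c * n%:R by rewrite ler_wpM2l // ler_nat.
have h3 := comp sigma.
move: hn; rewrite ltr_pdivrMr // => hn.
move: h1; rewrite natrM => h1; nra.
Qed.

End Adversary.

Local Close Scope nat_scope.
Local Close Scope fset_scope.

Theorem theorem12 (R : realType) :
  (exists A : algorithm,
     late_accept_reject_algorithm A /\ strictly_competitive A (2 : R)) /\
  (forall c : R, c < 2 ->
     forall A : algorithm,
       late_accept_reject_algorithm A -> ~ competitive A c).
Proof.
split; first by exists greedy_algorithm; split;
  [exact: greedy_legal | exact: greedy_strictly_competitive].
move=> c c2 A A_legal [alpha comp].
(* A negative [c] is replaced by 0: enlarging the ratio only weakens competitiveness, and the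
   argument for nonnegative ratios then applies. *)
have c'2 : Num.max c 0 < 2 by rewrite gt_max c2 ltr0n.
apply: (not_competitive A_legal) c'2 _; first by rewrite le_max lexx orbT.
exists alpha => sigma; apply: le_trans (comp sigma) _.
by rewrite lerD2r ler_wpM2r // le_max lexx.
Qed.
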